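(* Let $\mathcal{A},\mathcal{B}\subseteq M_n$ be unital commutative $*$-subalgebras of $M_n$, written as $$\mathcal{A} = U\Big(\bigoplus_{k=1}^{d_1}\mathbb{C}I_{m_k}\Big)U^*,\qquad \mathcal{B} = V\Big(\bigoplus_{k=1}^{d_2}\mathbb{C}I_{n_k}\Big)V^*,$$ where $U,V\in M_n$ are unitary and $m_1,\dots,m_{d_1}$, $n_1,\dots,n_{d_2}$ are positive integers with $\sum_{k=1}^{d_1}m_k=n=\sum_{k=1}^{d_2}n_k$. Let $X=X(U,V)$ be their block-index matrix. Then $\mathcal{A}$ and $\mathcal{B}$ are quasiorthogonal if and only if $X$ is quasiable with respect to $(m_1,\dots,m_{d_1})$ and $(n_1,\dots,n_{d_2})$.
   Context: $M_n$ is the algebra of $n\times n$ complex matrices. A unital $*$-subalgebra of $M_n$ is a complex subalgebra closed under conjugate transpose and containing $I_n$. Quasiorthogonality: unital $*$-subalgebras $\mathcal{A},\mathcal{B}\subseteq M_n$ are quasiorthogonal if $\mathrm{Tr}(AB)=\frac{\mathrm{Tr}(A)\mathrm{Tr}(B)}{n}$ for all $A\in\mathcal{A}$, $B\in\mathcal{B}$. Block-index matrix: $X(U,V)=(U^*V)\circ(\overline{U^*V})$, where $\circ$ is the entrywise (Schur) product and the bar is entrywise conjugation; that is, the $(i,j)$ entry of $X$ is $|(U^*V)_{i,j}|^2$. It is a doubly stochastic matrix. Quasiable: let $r=(m_1,\dots,m_{d_1})$ and $c=(n_1,\dots,n_{d_2})$ be tuples of positive integers each summing to $n$. An $n\times n$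 doubly stochastic matrix $D$ is quasiable with respect to $r$ and $c$ if, when the rows of $D$ are partitioned into consecutive groups of sizes $m_1,\dots,m_{d_1}$ and the columns into consecutive groups of sizes $n_1,\dots,n_{d_2}$, the sum of all entries in the $(i,j)$-block equals $\frac{m_in_j}{n}$ for all $1\le i\le d_1$, $1\le j\le d_2$. *)

(* Defs.v *)
From HB Require Import structures.
From mathcomp Require Import all_boot all_order all_algebra.
From mathcomp Require Import classical_sets reals.
From mathcomp Require Import complex.

Set Implicit Arguments.
Unset Strict Implicit.
Unset Printing Implicit Defensive.

Import Order.TTheory GRing.Theory Num.Theory.

Local Open Scope classical_set_scope.
Local Open Scope ring_scope.
Local Open Scope sesquilinear_scope.

Section Definitions.
Variables (C : numClosedFieldType) (n : nat).

Record unital_star_subalgebra (A : set 'M[C]_n) : Prop :=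
  UnitalStarSubalgebra {
    star_subalg1 : A 1%:M;
    star_subalgD : forall M N, A M -> A N -> A (M + N);
    star_subalgZ : forall (a : C) M, A M -> A (a *: M);
    star_subalgM : forall M N, A M -> A N -> A (M *m N);
    star_subalg_adj : forall M, A M -> A (M ^t*)
  }.

Definition commutative_subalgebra (A : set 'M[C]_n) : Prop :=
  forall M N, A M -> A N -> comm_mx M N.

Definition quasiorthogonal (A B : set 'M[C]_n) : Prop :=
  forall M N, A M -> B N -> \tr (M *m N) = \tr M * \tr N / n%:R.

(* U (C I_{m_0} (+) ... (+) C I_{m_{d-1}}) U^*; the library's block diagonal
   matrix has size \sum_k m k, and the cast only retypes it along that sum
   being n. *)
Definition block_scalar_algebra (d : nat) (m : 'I_d -> nat)
    (sum_m : (\sum_k m k)%N = n) (U : 'M[C]_n) : set 'M[C]_n :=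
  [set U *m castmx (sum_m, sum_m) (\mxdiag_k (a k)%:M) *m U ^t*
     | a in [set: 'I_d -> C]].

Definition schur_mx (M N : 'M[C]_n) : 'M[C]_n := map2_mx *%R M N.

Definition block_index_mx (U V : 'M[C]_n) : 'M[C]_n :=
  let W := U ^t* *m V in schur_mx W (map_mx Num.conj W).

(* In a numClosedFieldType, 0 <= x entails that x is real. *)
Definition doubly_stochastic (D : 'M[C]_n) : Prop :=
  [/\ forall i j, 0 <= D i j,
      forall i, \sum_j D i j = 1
    & forall j, \sum_i D i j = 1].

(* submxblock _ i j is the (i, j) block for the partitions of the rows and of
   the columns into consecutive groups of sizes r 0, r 1, ... and
   c 0, c 1, ... *)
Definition quasiable (d1 d2 : nat) (r : 'I_d1 -> nat) (c : 'I_d2 -> nat)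
    (sum_r : (\sum_k r k)%N = n) (sum_c : (\sum_k c k)%N = n)
    (D : 'M[C]_n) : Prop :=
  doubly_stochastic D /\
  forall i j,
    \sum_s \sum_t submxblock (castmx (esym sum_r, esym sum_c) D) i j s t
      = (r i)%:R * (c j)%:R / n%:R.

End Definitions.

(* Main.v *)
(* If M = U diag(a) U^* and N = V diag(b) V^*, with a and b constant on blocks,
   then Tr(M N) = \sum_(i, j) a_i b_j S_ij, where S_ij is the sum of the entries
   of X(U, V) in the (i, j) block, while
   Tr(M) Tr(N) / n = \sum_(i, j) a_i b_j m_i n_j / n.
   Both sides are bilinear in (a, b), so they agree for all a and b if and only
   if they agree on pairs of indicator functions, that is, if and only if
   S_ij = m_i n_j / n for all i and j.  Double stochasticity of X(U, V) is
   automatic because U^* V is unitary. *)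
Require Import Defs.
From HB Require Import structures.
From mathcomp Require Import all_boot all_order all_algebra.
From mathcomp Require Import classical_sets reals.
From mathcomp Require Import complex.

Set Implicit Arguments.
Unset Strict Implicit.
Unset Printing Implicit Defensive.

Import Order.TTheory GRing.Theory Num.Theory.

Local Open Scope classical_set_scope.
Local Open Scope ring_scope.

(** [tagnat] identifies a position with a pair (block, offset in the block); [tagnat.Rank] is the
    way back. *)
Lemma sum_tagnat (V : nmodType) d (p : 'I_d -> nat)
    (F : 'I_(\sum_k p k) -> V) :
  \sum_s F s = \sum_i \sum_j F (tagnat.Rank i j).
Proof.
rewrite sig_big_dep (reindex _ tagnat.sig_bij_on) /=.
apply: eq_bigr => s _.
by rewrite -/(tagnat.sig1 s) -/(tagnat.sig2 s) tagnat.sig2K.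
Qed.

Lemma mxdiag_scalarE (V : pzSemiRingType) d (p : 'I_d -> nat) (a : 'I_d -> V) :
  \mxdiag_k (a k)%:M = diag_mx (\row_s a (tagnat.sig1 s)) :> 'M_(\sum_k p k).
Proof.
apply/matrixP => s t; rewrite !mxE -(can_eq tagnat.sigK).
rewrite /tagnat.sig1 /tagnat.sig2.
case: (tagnat.sig s) (tagnat.sig t) => [/= i j] [/= i' j'].
(* In distinct blocks both entries vanish. In a common block, equality of positions reduces to
   equality of offsets. *)
case: eqP => [<-|ni] in j' *; last by rewrite !mxE; case: eqVneq => // -[].
by rewrite conform_mx_id eq_Tagged/= mxE.
Qed.

(** The weights depend only on the block of an index, so they factor out of each block sum. Separate
    sizes [n1] and [n2] let both sum equations be eliminated; with a shared size, eliminating one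
    would block the other. *)
Lemma sum_submxblock (S : comPzRingType) n1 n2 d1 d2
    (m : 'I_d1 -> nat) (p : 'I_d2 -> nat)
    (sum_m : (\sum_k m k)%N = n1) (sum_p : (\sum_k p k)%N = n2)
    (D : 'M[S]_(n1, n2)) (a : 'I_d1 -> S) (b : 'I_d2 -> S) :
  \sum_s \sum_t a (tagnat.sig1 (cast_ord (esym sum_m) s))
      * b (tagnat.sig1 (cast_ord (esym sum_p) t)) * D s t
  = \sum_i \sum_j a i * b j *
      \sum_s \sum_t submxblock (castmx (esym sum_m, esym sum_p) D) i j s t.
Proof.
case: _ / sum_m D; case: _ / sum_p => D.
rewrite castmx_id sum_tagnat; apply: eq_bigr => i _.
transitivity (\sum_s \sum_j \sum_t
    a i * b j * D (tagnat.Rank i s) (tagnat.Rank j t)).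
  apply: eq_bigr => s _; rewrite sum_tagnat.
  apply: eq_bigr => j _; apply: eq_bigr => t _.
  by rewrite !cast_ord_id !tagnat.Rank1K.
rewrite exchange_big; apply: eq_bigr => j _.
rewrite mulr_sumr; apply: eq_bigr => s _.
rewrite mulr_sumr; apply: eq_bigr => t _.
by rewrite mxE.
Qed.

Section BlockScalar.
Variables (C : numClosedFieldType) (n : nat).
Implicit Types U V : 'M[C]_n.

Local Open Scope sesquilinear_scope.

(** The general element of [block_scalar_algebra], named so that trace formulas can be stated in
    terms of its coefficients. *)
Definition block_scalar_mx d (m : 'I_d -> nat) (sum_m : (\sum_k m k)%N = n)
    U (a : 'I_d -> C) : 'M[C]_n :=
  U *m castmx (sum_m, sum_m) (\mxdiag_k (a k)%:M) *m U ^t*.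

Lemma block_scalar_diagE d (m : 'I_d -> nat) (sum_m : (\sum_k m k)%N = n)
    (a : 'I_d -> C) :
  castmx (sum_m, sum_m) (\mxdiag_k (a k)%:M) =
  diag_mx (\row_s a (tagnat.sig1 (cast_ord (esym sum_m) s))).
Proof.
rewrite mxdiag_scalarE; case: _ / sum_m; rewrite castmx_id.
by congr diag_mx; apply/rowP => s; rewrite !mxE cast_ord_id.
Qed.

Lemma mxtrace_block_scalar d (m : 'I_d -> nat) (sum_m : (\sum_k m k)%N = n)
    U a : U \is unitarymx ->
  \tr (block_scalar_mx sum_m U a) = \sum_k (m k)%:R * a k.
Proof.
move=> U_unitary; rewrite mxtrace_mulC mulmxA -invmx_unitary//.
rewrite mulVmx ?unitarymx_unit// mul1mx.
case: _ / sum_m U U_unitary => U _; rewrite castmx_id mxtrace_mxdiag.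
by apply: eq_bigr => k _; rewrite mxtrace_scalar mulr_natl.
Qed.

Lemma block_index_mxE U V i j :
  block_index_mx U V i j = `|(U ^t* *m V) i j| ^+ 2.
Proof. by rewrite [LHS]mxE [X in _ * X]mxE normCK. Qed.

Lemma mxtrace_mul_block_scalar d1 d2 (m : 'I_d1 -> nat) (p : 'I_d2 -> nat)
    (sum_m : (\sum_k m k)%N = n) (sum_p : (\sum_k p k)%N = n) U V a b :
  \tr (block_scalar_mx sum_m U a *m block_scalar_mx sum_p V b) =
  \sum_i \sum_j a i * b j * \sum_s \sum_t
    submxblock (castmx (esym sum_m, esym sum_p) (block_index_mx U V)) i j s t.
Proof.
rewrite -sum_submxblock /block_scalar_mx !block_scalar_diagE.
set Da := diag_mx _; set Db := diag_mx _.
have -> : U *m Da *m U ^t* *m (V *m Db *m V ^t*)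
    = U *m (Da *m (U ^t* *m V) *m Db *m V ^t*) by rewrite !mulmxA.
rewrite mxtrace_mulC -[_ *m _ *m U]mulmxA.
have -> : V ^t* *m U = (U ^t* *m V) ^t*.
  by rewrite trmx_mul map_mxM /= trmxCK.
rewrite mul_diag_mx mul_mx_diag; apply: eq_bigr => s _.
rewrite mxE; apply: eq_bigr => t _.
rewrite block_index_mxE normCK; move: (U ^t* *m V) => W; rewrite !mxE.
by rewrite mulrA [a _ * W _ _ * _]mulrAC.
Qed.

Lemma unitary_row_sqr_norm (W : 'M[C]_n) i :
  W \is unitarymx -> \sum_j `|W i j| ^+ 2 = 1.
Proof.
move=> /unitarymxP /matrixP /(_ i i); rewrite !mxE eqxx mulr1n => <-.
by apply: eq_bigr => j _; rewrite normCK !mxE.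
Qed.

Lemma block_index_mx_doubly_stochastic U V :
  U \is unitarymx -> V \is unitarymx ->
  doubly_stochastic (block_index_mx U V).
Proof.
move=> U_unitary V_unitary.
have W_unitary : U ^t* *m V \is unitarymx.
  by rewrite mul_unitarymx ?trmxC_unitary.
split=> [i j|i|j].
- by rewrite block_index_mxE exprn_ge0.
- under eq_bigr do rewrite block_index_mxE.
  exact: unitary_row_sqr_norm.
(* Column sums are row sums of the transpose, which is again unitary. *)
- under eq_bigr do rewrite block_index_mxE -[_ *m _]trmxK mxE.
  by apply: unitary_row_sqr_norm; rewrite trmx_unitary.
Qed.

Lemma quasiorthogonal_block_scalarP d1 d2 (m : 'I_d1 -> nat)
    (p : 'I_d2 -> nat) (sum_m : (\sum_k m k)%N = n)
    (sum_p : (\sum_k p k)%N = n) U V :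
  U \is unitarymx -> V \is unitarymx ->
  quasiorthogonal (block_scalar_algebra sum_m U) (block_scalar_algebra sum_p V)
  <-> quasiable sum_m sum_p (block_index_mx U V).
Proof.
move=> U_unitary V_unitary; split=> [qo|[_ blocks] _ _ [a _ <-] [b _ <-]].
  split=> [|i j]; first exact: block_index_mx_doubly_stochastic.
  (* The resulting matrices are projections with traces m_i and p_j. *)
  pose a k : C := (k == i)%:R; pose b k : C := (k == j)%:R.
  have a_in : block_scalar_algebra sum_m U (block_scalar_mx sum_m U a).
    by exists a.
  have b_in : block_scalar_algebra sum_p V (block_scalar_mx sum_p V b).
    by exists b.
  have sum_indicator d (l : 'I_d) (F : 'I_d -> C) :
      \sum_k F k * (k == l)%:R = F l.
    rewrite (bigD1 l) //= eqxx mulr1 big1 ?addr0 // => k /negPf ->.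
    by rewrite mulr0.
  have := qo _ _ a_in b_in.
  rewrite mxtrace_mul_block_scalar !mxtrace_block_scalar// !sum_indicator.
  (* Only the (i, j) term of the double sum survives, leaving that block sum alone. *)
  move=> <-; rewrite [RHS](bigD1 i) //= [X in _ + X]big1 => [|k /negPf ki].
    rewrite addr0 [RHS](bigD1 j) //= [X in _ + X]big1 => [|l /negPf lj].
      by rewrite addr0 /a /b !eqxx !mul1r.
    by rewrite /b lj mulr0 mul0r.
  by rewrite big1 // => l _; rewrite /a ki !mul0r.
(* Converse: the product of traces also expands into a double sum over blocks, and [blocks] matches
   the two sums term by term. *)
rewrite -!/(block_scalar_mx _ _ _) mxtrace_mul_block_scalar.
rewrite !mxtrace_block_scalar// !mulr_suml; apply: eq_bigr => i _.
rewrite mulr_sumr mulr_suml; apply: eq_bigr => j _; rewrite blocks.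
by rewrite [LHS]mulrA mulrACA [a i * _]mulrC [b j * _]mulrC.
Qed.

End BlockScalar.

Theorem theorem3p6 (R : realType) (n d1 d2 : nat)
  (A B : set 'M[R[i]]_n) (U V : 'M[R[i]]_n)
  (m : 'I_d1 -> nat) (p : 'I_d2 -> nat)
  (m_gt0 : forall k, (0 < m k)%N) (p_gt0 : forall k, (0 < p k)%N)
  (sum_m : (\sum_k m k)%N = n) (sum_p : (\sum_k p k)%N = n)
  (U_unitary : U \is unitarymx) (V_unitary : V \is unitarymx)
  (A_subalg : unital_star_subalgebra A) (A_comm : commutative_subalgebra A)
  (B_subalg : unital_star_subalgebra B) (B_comm : commutative_subalgebra B)
  (A_def : A = block_scalar_algebra sum_m U)
  (B_def : B = block_scalar_algebra sum_p V) :
  quasiorthogonal A B <-> quasiable sum_m sum_p (block_index_mx U V).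
Proof. by rewrite A_def B_def; exact: quasiorthogonal_block_scalarP. Qed.
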